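(* There exist sets $A \subseteq \mathbb{R}$ and $B \subseteq \mathbb{Z}$ with $D(A) = D(B) = 0$ such that for all real $\lambda \neq 0$, the set $$\big\lfloor P_\lambda(A \times B) \big\rfloor = \big\{ \lfloor a + \lambda b \rfloor \ \big|\ a \in A,\ b \in B \big\}$$ is thick in $\mathbb{Z}$, that is, contains arbitrarily long intervals (of consecutive integers).
   Context: For $\lambda \in \mathbb{R}$, $P_\lambda(a,b) = a + \lambda b$ for $(a,b) \in \mathbb{R}^2$. For $A \subseteq \mathbb{R}$, $\lfloor A \rfloor = \{\lfloor a \rfloor \mid a \in A\}$. For $A \subseteq \mathbb{R}$ and $\alpha \ge 0$, the $\alpha$-counting measure of $A$ is $$d^{\alpha}(A) = \lim_{\ell\to\infty} \sup_{\|C\| \ge \ell} \frac{|\lfloor A \rfloor \cap C|}{\|C\|^\alpha},$$ where the supremum is over intervals $C = [a, a + \|C\|)$ of length $\|C\| \ge \ell$. The counting dimension is $D(A) = \inf\{\alpha \ge 0 \mid d^\alpha(A) = 0\}$. *)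

(* Defs.v *)
From mathcomp Require Import all_boot all_order all_algebra.
From mathcomp Require Import all_classical all_reals all_analysis.

Set Implicit Arguments.
Unset Strict Implicit.
Unset Printing Implicit Defensive.

Import Order.TTheory GRing.Theory Num.Theory.
Import numFieldNormedType.Exports.

Local Open Scope classical_set_scope.
Local Open Scope ring_scope.

Section CountingDimension.
Context {R : realType}.
Implicit Types (A : set R) (alpha lambda : R).

Definition floor_image A : set int := [set Num.floor a | a in A].

(* The integer points of the half-open interval [a, a + len). *)
Definition int_window (a len : R) : set int :=
  [set n : int | a <= n%:~R < a + len].

Definition window_ratio alpha A (a len : R) : \bar R :=
  (counting (floor_image A `&` int_window a len) / (len `^ alpha)%:E)%E.

Definition sup_ratio alpha A (l : R) : \bar R :=
  ereal_sup [set x | exists a len : R,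
                       l <= len /\ x = window_ratio alpha A a len].

(* The function sup_ratio alpha A is nonincreasing, so the limit exists in
   \bar R. *)
Definition alpha_counting alpha A : \bar R :=
  lim (sup_ratio alpha A l @[l --> +oo%R]).

(* The infimum is taken in \bar R; the set is never empty, since every
   alpha > 1 belongs to it. *)
Definition counting_dim A : \bar R :=
  ereal_inf [set alpha%:E | alpha in
    [set alpha : R | 0 <= alpha /\ alpha_counting alpha A = 0%E]].

Definition proj_line lambda (p : R * R) : R := p.1 + lambda * p.2.

End CountingDimension.

Definition int_embed (R : realType) (B : set int) : set R :=
  [set n%:~R | n in B].
Arguments int_embed : clear implicits.

Definition thick (S : set int) : Prop :=
  forall N : nat, exists m : int, forall i : nat, (i < N)%N -> S (m + i%:Z).

(* Main.v *)
Require Import Defs.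
From mathcomp Require Import all_boot all_order all_algebra.
From mathcomp Require Import all_classical all_reals all_analysis.
From mathcomp Require Import lra zify ring.

Import Order.TTheory GRing.Theory Num.Theory.
Import numFieldNormedType.Exports.

Local Open Scope classical_set_scope.
Local Open Scope ring_scope.

(** Take for B the powers of 4, so that for fixed lambda <> 0 the numbers
    lambda * 4 ^ (K + i), i = 0, 1, ..., have gaps that grow exponentially in
    i, and are as large as desired once K is.  To hit the integers
    t, t + 1, ..., t + N - 1 with a + lambda * b it suffices that A contain
    a_i = t + i - lambda * 4 ^ (K + i) for i < N.  The floors of the a_i are
    t + J_i, where J_i = i + floor (- lambda * 4 ^ (K + i)) is a finite
    integer sequence whose gaps are exponentially large (spread_floors).

    There are uncountably many lambda but only countably many finite integer
    sequences J, and t is free to depend on J.  So A can be the set of all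
    reals whose floor lies in the union of the translates t_J + J over all
    exponentially spread finite sequences J: reals with a prescribed floor
    absorb the fractional part of lambda * b.  The translations t_J are chosen
    so that different translates are very far apart (exists_far_apart).

    This union has dimension 0 (exists_spread_container): index its points by
    pairs (n, i), meaning the i-th entry of the n-th sequence.  An interval of
    length at most 2 ^ k that contains two points of the union only contains
    points with i < k and, if two sequences occur in it, with n < k.  Hence it
    contains O(k ^ 2) points (counting_dim_eq0_of_spread), and polylogarithmic
    window counts force dimension 0 (counting_dim_eq0_of_log_counts). *)

(** * Polylogarithmic window counts give dimension zero *)

(** Bernoulli's inequality for 2 `^ b: the logarithm of x to base 2 is at most
    a constant times any positive power of x. *)
Lemma log2_le_powR (R : realType) (b : R) (k : nat) (x : R) : 0 < b ->
  2 ^+ k <= x -> 1 + k%:R * (2 `^ b - 1) <= x `^ b.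
Proof.
move=> b0 kx; apply: (@le_trans _ _ ((2 ^+ k) `^ b)); last first.
  by apply: ge0_ler_powR; rewrite ?nnegrE ?exprn_ge0 ?(ltW b0)// (le_trans _ kx)// exprn_ge0.
have -> : (2 ^+ k) `^ b = (2 `^ b) ^+ k :> R.
  by rewrite -powR_mulrn// -powRrM mulrC powRrM powR_mulrn ?powR_ge0.
have : 1 <= 2 `^ b :> R by rewrite -[leLHS](congr1 (@^~ b) (powR1 R)); apply: ge0_ler_powR; rewrite ?nnegrE ?ltW//; lra.
set y := 2 `^ b => y1.
elim: k {kx} => [|k IH]; first by rewrite mul0r addr0 expr0.
rewrite exprS -natr1.
apply: (@le_trans _ _ (y * (1 + k%:R * (y - 1)))); last by rewrite ler_wpM2l//; lra.
rewrite -subr_ge0 [leRHS](_ : _ = k%:R * (y - 1) ^+ 2); last by ring.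
by rewrite mulr_ge0// sqr_ge0.
Qed.

Lemma powR_inv_small (R : realType) (b C e : R) : 0 < b -> 0 < C -> 0 < e ->
  \forall l \near +oo, C / l `^ b <= e.
Proof.
move=> b0 C0 e0; near=> l.
have l0 : 0 < l by near: l; apply: nbhs_pinfty_gt; rewrite num_real.
rewrite ler_pdivrMr ?powR_gt0// mulrC -ler_pdivrMr//.
have -> : C / e = ((C / e) `^ b^-1) `^ b.
  by rewrite -powRrM mulVf ?gt_eqF// powRr1// divr_ge0 ?ltW.
have ll : (C / e) `^ b^-1 <= l by near: l; apply: nbhs_pinfty_ge; rewrite num_real.
by apply: ge0_ler_powR; rewrite ?nnegrE ?powR_ge0// ltW.
Unshelve. all: by end_near. Qed.

(** For alpha > 0 and b = alpha / 4, log2_le_powR bounds the count in a window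
    of length len by D * len `^ (2 * b), so its ratio to len `^ (4 * b) is
    O(len `^ (- b)) and tends to 0. *)
Lemma counting_dim_eq0_of_log_counts (R : realType) (A : set R) :
  (forall (k : nat) (a len : R), len <= 2 ^+ k ->
    (@counting int R (floor_image A `&` int_window a len) <= ((k.+1 ^ 2)%:R)%:E)%E) ->
  counting_dim A = 0%E.
Proof.
move=> cnt; apply/eqP; rewrite eq_le; apply/andP; split; last first.
  by apply/ereal_infP => _ [alpha [a0 _] <-]; rewrite lee_fin.
apply/lee_addgt0Pr => alpha a0; rewrite add0e; apply: ereal_inf_lbound.
exists alpha => //; split; first exact: ltW.
apply/cvg_lim => //.
pose b := alpha / 4; have b0 : 0 < b by rewrite divr_gt0.
pose c : R := 2 `^ b - 1.
have c0 : 0 < c.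
  by rewrite subr_gt0 -[ltLHS](congr1 (@^~ b) (powR1 R)); apply: gt0_ltr_powR; rewrite ?nnegrE//; lra.
pose D := (2 + c^-1) ^+ 2.
have D0 : 0 < D by rewrite exprn_gt0// addr_gt0// invr_gt0.
have ratio_le a len : 1 <= len -> (window_ratio alpha A a len <= (D / len `^ b)%:E)%E.
  move=> len1; have len0 : 0 < len by lra.
  rewrite /window_ratio inver gt_eqF ?powR_gt0//.
  have /andP[tl lt] := truncn_itv (ltW len0).
  have t0 : (0 < Num.truncn len)%N by rewrite truncn_gt0.
  have /andP[kt tk] := trunc_log_bounds (isT : 1 < 2)%N t0.
  set k := trunc_log 2 _ in kt tk.
  have lek : 2 ^+ k <= len.
    by apply: le_trans tl; rewrite -natrX ler_nat.
  have ltk : len <= 2 ^+ k.+1.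
    by apply/ltW/(lt_le_trans lt); rewrite -natrX ler_nat.
  (* The hypothesis on counts is used with exponent k.+1, as 2 ^+ k <= len. *)
  have kc := @log2_le_powR R b k len b0 lek.
  have ay : len `^ alpha = (len `^ b) ^+ 4.
    by rewrite -powR_mulrn ?powR_ge0// -powRrM /b divfK.
  apply: (@le_trans _ _ (((k.+2 ^ 2)%:R)%:E * ((len `^ alpha)^-1)%:E)%E).
    by apply: lee_wpmul2r; rewrite ?lee_fin ?invr_ge0 ?powR_ge0//; exact: cnt.
  rewrite -EFinM lee_fin ay.
  move: kc; rewrite -/c; set y := len `^ b => kc.
  have k0 : 0 <= k%:R :> R by [].
  have y1 : 1 <= y by apply: le_trans kc; rewrite lerDl mulr_ge0// ltW.
  have ky : k.+2%:R <= (2 + c^-1) * y.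
    have -> : k.+2%:R = k%:R + 2 :> R by rewrite -addn2 natrD.
    have : (2 + c^-1) * (1 + k%:R * c) <= (2 + c^-1) * y.
      by rewrite ler_wpM2l// addr_ge0// invr_ge0 ltW.
    apply: le_trans.
    have -> : (2 + c^-1) * (1 + k%:R * c) = 2 + 2 * (k%:R * c) + c^-1 + k%:R.
      by field; rewrite gt_eqF.
    have : 0 <= k%:R * c by rewrite mulr_ge0// ltW.
    have : 0 < c^-1 by rewrite invr_gt0.
    lra.
  have y0 : 0 < y by lra.
  rewrite ler_pdivrMr ?exprn_gt0//.
  have -> : D / y * y ^+ 4 = ((2 + c^-1) * y) ^+ 2 * y.
    by rewrite /D; move: (2 + c^-1) => z; rewrite exprMn; field; rewrite gt_eqF.
  rewrite natrX; apply: (@le_trans _ _ (((2 + c^-1) * y) ^+ 2)).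
    by rewrite ler_pXn2r ?nnegrE// (le_trans _ ky).
  by rewrite ler_peMr// sqr_ge0.
have sup_le l : 1 <= l -> (sup_ratio alpha A l <= (D / l `^ b)%:E)%E.
  move=> l1; apply: ge_ereal_sup => _ [a [len [ll ->]]].
  apply: (le_trans (ratio_le _ _ (le_trans l1 ll))).
  rewrite lee_fin ler_wpM2l ?(ltW D0)// lef_pV2 ?posrE ?powR_gt0//; try lra.
  by apply: ge0_ler_powR; rewrite ?nnegrE; lra.
have sup_ge l : 1 <= l -> (0 <= sup_ratio alpha A l)%E.
  move=> l1; apply: (@le_trans _ _ (window_ratio alpha A 0 l)); last first.
    by apply: ereal_sup_ubound; exists 0, l.
  rewrite /window_ratio inver gt_eqF ?powR_gt0//; last lra.
  apply: mule_ge0; last by rewrite lee_fin invr_ge0 powR_ge0.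
  by rewrite /counting; case: asboolP.
apply: (@squeeze_cvge _ _ _ _ (fun=> 0%E) _ (fun l => (D / l `^ b)%:E)).
- near=> l; have l1 : 1 <= l by near: l; apply: nbhs_pinfty_ge; rewrite num_real.
  by rewrite sup_ge// sup_le.
- exact: cvg_cst.
- apply/cvg_EFin; first by near=> l.
  apply/cvgrPdist_le => e e0; near=> l => /=.
  rewrite sub0r normrN ger0_norm; last by rewrite divr_ge0 ?powR_ge0 ?ltW.
  by near: l; exact: (@powR_inv_small R b D e).
Unshelve. all: by end_near. Qed.

(** * Doubly indexed sets with exponential gaps *)

Lemma counting_le_size (R : realType) (T : choiceType) (X : set T) (t : seq T) :
  X `<=` [set` t] -> (@counting T R X <= ((size t)%:R)%:E)%E.
Proof.
move=> Xt; have fX : finite_set X by exact: sub_finite_set Xt (finite_seq t).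
rewrite /counting asboolT// lee_fin ler_nat.
apply: uniq_leq_size; first exact: finmap.fset_uniq.
by move=> x; rewrite in_fset_set// inE => /Xt.
Qed.

(** The two separations are asymmetric on purpose: points with the same first
    index need only be 2 ^ u.2 apart, which leaves a fixed cluster free to
    occupy an arbitrarily late position n.  A window of length at most 2 ^ k
    containing the point of index u thus contains, besides that point, only
    points with second index < k and first index u.1 or < k. *)
Lemma counting_dim_eq0_of_spread (R : realType) (A : set R)
    (p : set (nat * nat)) (s : nat * nat -> int) :
  floor_image A = s @` p ->
  (forall u v, p u -> p v -> u != v -> (2 ^ u.2 <= `|s u - s v|)%N) ->
  (forall u v, p u -> p v -> u.1 != v.1 -> (2 ^ u.1 <= `|s u - s v|)%N) ->
  counting_dim A = 0%E.
Proof.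
move=> As sep2 sep1; apply: counting_dim_eq0_of_log_counts => k a len lenk.
have close m n : int_window a len m -> int_window a len n -> (`|m - n| < 2 ^ k)%N.
  move=> /andP[am ma] /andP[an na].
  rewrite -(@ltr_nat R) natr_absz natrX intr_norm rmorphB /=.
  rewrite ltr_norml; apply/andP; split; lra.
rewrite As.
have [->|/set0P[_ [[u pu <-] wu]]] := eqVneq (s @` p `&` int_window a len) set0.
  by apply: (@le_trans _ _ ((size (@nil int))%:R)%:E); [exact: counting_le_size|rewrite lee_fin ler_nat].
pose t := s u :: [seq s (n, i) | n <- u.1 :: iota 0 k, i <- iota 0 k].
apply: (@le_trans _ _ ((size t)%:R)%:E); last first.
  by rewrite lee_fin ler_nat /= size_cat size_map size_allpairs !size_iota; lia.
apply: counting_le_size => _ [[v pv <-] wv].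
have [->|vu] := eqVneq v u; first exact: mem_head.
have vk := close _ _ wv wu.
have ltk n : (2 ^ n <= `|s v - s u|)%N -> n \in iota 0 k.
  by move=> /leq_ltn_trans/(_ vk); rewrite ltn_exp2l// mem_iota.
rewrite /= /t in_cons; apply/orP; right; apply/allpairsP; exists v.
split; [|exact/ltk/sep2|by rewrite -surjective_pairing].
rewrite in_cons; have [//|v1] := eqVneq v.1 u.1.
exact/ltk/sep1.
Qed.

(** * The two sets *)

Lemma exp4_gap (i j : nat) : (i < j)%N -> (2 ^ j + 4 ^ i <= 4 ^ j)%N.
Proof.
case: j => // j; rewrite ltnS => ij.
have : (4 ^ i <= 4 ^ j)%N by rewrite leq_exp2l.
have : (2 ^ j <= 4 ^ j)%N by rewrite -[4%N]/(2 ^ 2)%N -expnM leq_exp2l// leq_pmull.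
by rewrite !expnS; lia.
Qed.

(** With W n the sum of the weights below n, t n = W n + W n.+1 places point n
    in the middle of the n-th of consecutive intervals of lengths 2 * w n. *)
Lemma exists_far_apart (w : nat -> nat) :
  exists t : nat -> int, forall m n, m != n -> (w m + w n <= `|t m - t n|)%N.
Proof.
pose W n := (\sum_(0 <= k < n) w k)%N.
exists (fun n => (W n + W n.+1)%N) => m n.
wlog mn : m n / (m < n)%N.
  move=> th; rewrite neq_ltn => /orP[mn|nm]; first by apply: th; rewrite ?ltn_eqF.
  by rewrite addnC distnC; apply: th; rewrite ?ltn_eqF.
move=> _.
have Wm : (W m.+1 = W m + w m)%N by rewrite /W big_nat_recr.
have Wn : (W n.+1 = W n + w n)%N by rewrite /W big_nat_recr.
have : (W m.+1 <= W n)%N by rewrite /W (@big_cat_nat _ _ _ m.+1 0 n)//= leq_addr.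
lia.
Qed.

Lemma exp4_gap_abs (i j : nat) : i != j -> (2 ^ j <= `|(4 ^ i)%N%:Z - (4 ^ j)%N%:Z|)%N.
Proof.
rewrite neq_ltn => /orP[] /[dup] lt_ij /exp4_gap; first lia.
by have := ltnW lt_ij; rewrite -(@leq_exp2l 2)//; lia.
Qed.

Lemma counting_dim_powers4 (R : realType) :
  counting_dim (int_embed R (range (fun i : nat => (4 ^ i)%N%:Z))) = 0%E.
Proof.
apply: (@counting_dim_eq0_of_spread R _ [set u | u.1 = 0%N] (fun u => (4 ^ u.2)%N%:Z)).
- apply/seteqP; split=> [_ [_ [_ [i _ <-] <-] <-]|_ [[n i] /= _ <-]].
    by exists (0%N, i); rewrite //= intrKfloor.
  by exists (4 ^ i)%N%:Z%:~R; [exists (4 ^ i)%N%:Z => //; exists i|rewrite intrKfloor].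
- move=> [n i] [m j] /= -> ->; rewrite xpair_eqE /= distnC => ij.
  by apply: exp4_gap_abs; rewrite eq_sym.
- by move=> u v -> ->; rewrite eqxx.
Qed.

(** As i and j may be exchanged, the gap is at least 2 ^ maxn i j. *)
Definition spread (J : seq int) : Prop := forall i j : nat,
  (i < size J)%N -> (j < size J)%N -> i != j -> (2 ^ i <= `|(J`_i - J`_j)%R|)%N.

(** A single set of dimension 0 that contains a translate of every spread
    sequence.  The weight w n bounds the entries of the n-th sequence and leaves
    room for the gaps 2 ^ n and 2 ^ size (J n), which gives both separations
    of counting_dim_eq0_of_spread between distinct sequences; within one
    sequence the separation is spreadness. *)
Lemma exists_spread_container (R : realType) : exists A : set R,
  counting_dim A = 0%E /\
  forall J : seq int, spread J -> exists t : int,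
    forall (i : nat) (a : R), (i < size J)%N -> Num.floor a = t + J`_i -> A a.
Proof.
(* J enumerates all finite integer sequences; those that are not spread are
   discarded by p. *)
pose J (n : nat) : seq int := odflt [::] (unpickle n).
pose w n := (2 ^ n + 2 ^ size (J n) + \sum_(x <- J n) `|x|)%N.
have [t tP] := exists_far_apart w.
pose p : set (nat * nat) := [set u | spread (J u.1) /\ (u.2 < size (J u.1))%N].
pose s (u : nat * nat) : int := t u.1 + (J u.1)`_u.2.
exists [set a | (s @` p) (Num.floor a)]; split; last first.
  move=> L spL; exists (t (pickle L)) => i a iL fa.
  have JL : J (pickle L) = L by rewrite /J pickleK.
  by exists (pickle L, i); rewrite /p /s /= JL.
have far u v : p u -> p v -> u.1 != v.1 -> (2 ^ u.1 + 2 ^ u.2 <= `|s u - s v|)%N.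
  move=> [_ u2] [_ v2] /tP; rewrite /w /s.
  have abs_le n i : (i < size (J n))%N -> (`|((J n)`_i)%R| <= \sum_(x <- J n) `|x|)%N.
    by move=> iJ; rewrite (big_nth 0) big_mkord (bigD1 (Ordinal iJ))//= leq_addr.
  have := abs_le _ _ u2; have := abs_le _ _ v2.
  have : (2 ^ u.2 <= 2 ^ size (J u.1))%N by rewrite leq_exp2l// ltnW.
  lia.
apply: (@counting_dim_eq0_of_spread R _ p s).
- apply/seteqP; split=> [_ [a sa <-]//|m sm].
  by exists m%:~R => /=; rewrite intrKfloor.
- move=> u v pu pv; have [uv1 uv|/(far _ _ pu pv) + _] := eqVneq u.1 v.1; last first.
    by apply: leq_trans; rewrite leq_addl.
  have [[spu u2] [_ v2]] := (pu, pv); rewrite /s -uv1.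
  rewrite -uv1 in v2.
  rewrite opprD addrACA subrr add0r; apply: spu => //.
  apply: contra_neq uv; move: uv1; case: u {pu u2 v2} => ? ?; case: v {pv} => ? ? /=.
  by move=> -> ->.
- by move=> u v pu pv /(far _ _ pu pv); apply: leq_trans; rewrite leq_addr.
Qed.

Lemma dist_floor_ge (R : realType) (x y : R) :
  `|x - y| - 1 <= `|Num.floor x - Num.floor y|%N%:R.
Proof.
rewrite natr_absz intr_norm intrD mulrNz.
have := floor_itv x; have := floor_itv y; rewrite !intrD.
move: (Num.floor x)%:~R (Num.floor y)%:~R => a b /andP[? ?] /andP[? ?].
rewrite lerBlDr ler_norml; have := ler_norm (a - b); have := lerNnormlW (lexx `|a - b|).
by move: `|a - b| => c ? ?; apply/andP; split; lra.
Qed.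

(** Taking floors and adding i shortens each distance by less than N; this is
    absorbed because the distance |lambda| * 4 ^ K * |4 ^ i - 4 ^ j| exceeds
    the required 2 ^ i by the factor |lambda| * 4 ^ K >= N + 2. *)
Lemma spread_floors (R : realType) (lambda : R) (K N : nat) :
  N.+2%:R <= `|lambda| * 4 ^+ K ->
  spread (mkseq (fun i => i%:Z + Num.floor (- (lambda * (4 ^ (K + i))%N%:R))) N).
Proof.
move=> big i j; rewrite size_mkseq => iN jN ij; rewrite !nth_mkseq//.
pose x k : R := - (lambda * (4 ^ (K + k))%N%:R).
rewrite -/(x i) -/(x j).
have gap : (N.+2 * 2 ^ i)%N%:R <= `|x i - x j|.
  rewrite -opprD normrN -mulrBr !expnD !natrM -mulrBr 2!normrM normr_nat mulrA.
  rewrite [(4 ^ K)%:R]natrX; apply: ler_pM => //.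
  have := exp4_gap_abs j i; rewrite eq_sym => /(_ ij).
  by rewrite -(@ler_nat R) natr_absz intr_norm intrD mulrNz distrC.
have : (N + 2 ^ i <= `|Num.floor (x i) - Num.floor (x j)|)%N.
  rewrite -(@ler_nat R); apply: le_trans (dist_floor_ge _ _ _).
  rewrite lerBrDr natr1; apply: le_trans gap; rewrite ler_nat.
  by have := expn_gt0 2 i; nia.
lia.
Qed.

(** * Thickness of the projections *)

Theorem proposition3p11 (R : realType) :
  exists (A : set R) (B : set int),
    [/\ counting_dim A = 0%E,
        counting_dim (int_embed R B) = 0%E &
        forall lambda : R, lambda != 0 ->
          thick (floor_image (proj_line lambda @` (A `*` int_embed R B)))].
Proof.
have [A [A0 AP]] := exists_spread_container R.
exists A, (range (fun i : nat => (4 ^ i)%N%:Z)).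
split; [exact: A0|exact: counting_dim_powers4|].
move=> lambda l0 N.
pose q := N.+2%:R / `|lambda|.
have lp : 0 < `|lambda| by rewrite normr_gt0.
pose K := Num.bound q.
have big : N.+2%:R <= `|lambda| * 4 ^+ K.
  rewrite mulrC -ler_pdivrMr//; apply: (@le_trans _ _ K%:R).
    by apply/ltW/archi_boundP; rewrite divr_ge0 ?ltW.
  by rewrite -natrX ler_nat ltnW// ltn_expl.
have [t tP] := AP _ (@spread_floors R lambda K N big).
exists t => i iN.
exists (t + i%:Z)%:~R; last by rewrite intrKfloor.
pose b : R := (4 ^ (K + i))%N%:R.
exists ((t + i%:Z)%:~R - lambda * b, b) => /=; last by rewrite /proj_line /= subrK.
split=> /=; last by exists (4 ^ (K + i))%N%:Z => //; exists (K + i)%N.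
apply: (tP i); first by rewrite size_mkseq.
by rewrite nth_mkseq// floorDzr ?intr_int// intrKfloor addrA.
Qed.
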